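(* Let $n\in\mathbb{N}$. A signed subset $S\subseteq\pm[n]$ lies in $\mathsf{APS}^B_n$ if and only if, writing $P(S)=S\cap[n]$ and $N(S)=S\cap -[n]$, all of the following hold: (i) $|P(S)|+|N(S)|\le (n-1)/2$; (ii) $P(S)\subset[n]$; (iii) $N(S)\subset -([n]\setminus P(S))$; (iv) $N(S)\in\mathsf{APS}\big(-([n]\setminus P(S))\big)$.
   Context: $[n]=\{1,\dots,n\}$, $-X=\{-x:x\in X\}$, $\pm[n]=[n]\cup-[n]$. A signed set is a set $I$ such that $x\in I$ implies $-x\notin I$. $\mathfrak{S}_n^B$ is the group of bijections $w:\pm[n]\to\pm[n]$ with $w(-i)=-w(i)$, written in one-line notation $w(1)\cdots w(n)$. For any sequence $a_1a_2\cdots a_m$ of distinct real numbers, a pinnacle is a value $a_i$ with $2\le i\le m-1$ and $a_{i-1}<a_i>a_{i+1}$; the pinnacle set is the set of pinnacles. $\mathsf{APS}^B_n$ is the set of pinnacle sets of one-line notations of elements of $\mathfrak{S}_n^B$. For a finite totally ordered set $X$, $\mathsf{APS}(X)$ is the set of all pinnacle sets of sequences listing each element of $X$ exactly once. *)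

(* Defs.v *)
From HB Require Import structures.
From mathcomp Require Import all_boot all_order all_algebra.
From mathcomp Require Import finmap.

Set Implicit Arguments.
Unset Strict Implicit.
Unset Printing Implicit Defensive.

Import Order.TTheory GRing.Theory Num.Theory.

Local Open Scope fset_scope.
Local Open Scope ring_scope.

Section Pinnacles.
Local Open Scope order_scope.

(* Positions are 0-based, so the interior positions 2 <= i <= m - 1 of
   a_1 ... a_m become 0 < i and i + 1 < m. The default x of nth is never
   returned. *)
Definition is_pinnacle (d : Order.disp_t) (T : orderType d) (s : seq T) (x : T)
    : bool :=
  [exists i : 'I_(size s),
    [&& (0 < i)%N, (i.+1 < size s)%N, nth x s i == x,
        nth x s i.-1 < x & x > nth x s i.+1]].

Definition pinnacle_set (d : Order.disp_t) (T : orderType d) (s : seq T)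
    : {fset T} :=
  [fset x in s | is_pinnacle s x].

Definition APS (d : Order.disp_t) (T : orderType d) (X S : {fset T}) : Prop :=
  exists s : seq T, [/\ uniq s, s =i X & pinnacle_set s = S].

End Pinnacles.

(* [n] = {1, ..., n}, as a set of integers. *)
Definition pos_range (n : nat) : {fset int} := [fset i%:Z | i in iota 1 n].

Definition fset_opp (X : {fset int}) : {fset int} := [fset - x | x in X].

Definition pm_range (n : nat) : {fset int} :=
  pos_range n `|` fset_opp (pos_range n).

Definition signed_set (X : {fset int}) : Prop :=
  {in X, forall x : int, - x \notin X}.

(* w represents a bijection of pm_range n; its values outside pm_range n are
   irrelevant. *)
Definition signed_perm (n : nat) (w : int -> int) : Prop :=
  [/\ {in pm_range n, forall i, w i \in pm_range n},
      {in pm_range n &, injective w},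
      {in pm_range n, forall j, exists2 i, i \in pm_range n & w i = j}
    & {in pm_range n, forall i, w (- i) = - w i}].

Definition one_line (n : nat) (w : int -> int) : seq int :=
  [seq w i%:Z | i <- iota 1 n].

Definition APSB (n : nat) (S : {fset int}) : Prop :=
  exists w : int -> int, signed_perm n w /\ pinnacle_set (one_line n w) = S.

Definition pos_part (n : nat) (S : {fset int}) : {fset int} :=
  S `&` pos_range n.

Definition neg_part (n : nat) (S : {fset int}) : {fset int} :=
  S `&` fset_opp (pos_range n).

(* Main.v *)
Require Import Defs.
From HB Require Import structures.
From mathcomp Require Import all_boot all_order all_algebra.
From mathcomp Require Import finmap zify.

(** A set [S] is the pinnacle set of some arrangement of [X] iff every [p] in [S]
    has more elements of [X \ S] below it than elements of [S] at most [p].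
    Necessity counts the neighbours of the pinnacles; for sufficiency, interleave
    the sorted pinnacles with the smallest non-pinnacles.  In a signed
    permutation, replacing each non-pinnacle [x] by [- |x|] can only increase
    these counts, so one may take [X = P(S) U -([n] \ P(S))].  For negative [p] the
    criterion is then exactly the one for [N(S)] in [-([n] \ P(S))]; for positive
    [p] every non-pinnacle is below [p], and the criterion follows from the bound
    on the cardinality of [S]. *)

Set Implicit Arguments.
Unset Strict Implicit.
Unset Printing Implicit Defensive.

Import Order.TTheory GRing.Theory Num.Theory.

Local Open Scope fset_scope.
Local Open Scope ring_scope.

Section AdmissiblePinnacleSets.
Local Open Scope order_scope.
Context (d : Order.disp_t) (T : orderType d).
Implicit Types (s v a : seq T) (x y z q p : T) (X S : {fset T}).

(** * Locating pinnacles in a sequence *)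

Lemma is_pinnacle_index s x : uniq s ->
  is_pinnacle s x =
  [&& (0 < index x s)%N, ((index x s).+1 < size s)%N,
      nth x s (index x s).-1 < x & nth x s (index x s).+1 < x].
Proof.
move=> us; apply/existsP/and4P => [[i /and5P[i0 i1 /eqP ix l r]]|[i0 i1 l r]].
  have <- : nat_of_ord i = index x s by rewrite -ix index_uniq.
  by split.
exists (Ordinal (ltnW i1)); apply/and5P; split=> //=.
by rewrite nth_index // -index_mem ltnW.
Qed.

Lemma is_pinnacle_cons x y z s q :
  is_pinnacle [:: x, y, z & s] q =
  [&& q == y, x < y & z < y] || is_pinnacle [:: y, z & s] q.
Proof.
apply/existsP/orP => [[[[|[|i]] im] /and5P[] // _ i1 /eqP ix l r]|].
- by left; rewrite /= in ix l r; rewrite ix eqxx l r.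
- right; apply/existsP; have im' : (i.+1 < size [:: y, z & s])%N by [].
  by exists (Ordinal im'); apply/and5P; split=> //=; apply/eqP.
case=> [/and3P[/eqP-> l r]|/existsP[[i /= im] /and5P[i0 i1 ix l r]]].
  have im : (1 < size [:: x, y, z & s])%N by [].
  by exists (Ordinal im); apply/and5P; split=> //=.
have im' : (i.+1 < size [:: x, y, z & s])%N by [].
exists (Ordinal im'); apply/and5P; split=> //=.
(* Shifting commutes with the truncated [i.-1] only because [i] is positive. *)
by case: i i0 {im i1 ix r im'} l.
Qed.

Lemma is_pinnacle_short s q : (size s < 3)%N -> is_pinnacle s q = false.
Proof.
move=> s3; apply/existsP => -[i /and5P[i0 i1 _ _ _]].
by have := leq_trans i1 s3; lia.
Qed.

Lemma is_pinnacle_sorted s q : sorted <%O s -> is_pinnacle s q = false.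
Proof.
elim: s => [|x [|y [|z s]] IH]; try by rewrite is_pinnacle_short.
move=> xs; rewrite is_pinnacle_cons; move: xs => /= /and3P[xy yz zs].
by rewrite IH /= ?yz // (lt_gtF yz) !andbF.
Qed.

(** * Interleaving valleys and peaks *)

(** Valleys [v] alternate with peaks [a], starting with a valley; the surplus of [v] ends the
    sequence, while a surplus of [a] would be lost. *)
Fixpoint zigzag v a : seq T :=
  match v, a with
  | y :: v', x :: a' => [:: y, x & zigzag v' a']
  | _, _ => v
  end.

Lemma zigzag_nil v : zigzag v [::] = v. Proof. by case: v. Qed.

Lemma perm_zigzag v a : (size a <= size v)%N -> perm_eq (zigzag v a) (v ++ a).
Proof.
elim: v a => [|y v IH] [|x a] //=; first by rewrite cats0.
move=> av; rewrite perm_cons -[x :: a]cat1s perm_sym perm_catCA perm_sym.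
by rewrite /= perm_cons IH.
Qed.

(** The [i]-th peak stands between valleys [i] and [i.+1]; as [v] increases, exceeding the right one
    suffices. The increasing surplus of [v] adds no pinnacle. *)
Lemma is_pinnacle_zigzag x0 v a q : sorted <%O v ->
  (a != [::] -> size a < size v)%N ->
  (forall i, (i < size a)%N -> nth x0 v i.+1 < nth x0 a i) ->
  is_pinnacle (zigzag v a) q = (q \in a).
Proof.
elim: a v => [|x a IH] v sv av va; first by rewrite zigzag_nil is_pinnacle_sorted.
case: v sv av va => [|y [|z v]] //=; try by move=> ? /(_ isT).
move=> /andP[yz zv] av va; have zx := va 0%N isT; rewrite /= in zx.
have {}IH : is_pinnacle (zigzag (z :: v) a) q = (q \in a).
  by apply: IH => // [_|i ia]; [exact: av | exact: (va i.+1)].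
have zE : exists t, zigzag (z :: v) a = z :: t.
  by case: (a) => [|? ?]; eexists.
rewrite -/(zigzag (z :: v) a); case: zE IH => t -> IH.
rewrite is_pinnacle_cons zx (lt_trans yz zx) andbT /= in_cons andbT -IH.
(* Putting [x] in front of [z] creates no pinnacle at [z], since [z < x]. *)
congr (_ || _); case: t {IH} => [|u t]; first by rewrite !is_pinnacle_short.
by rewrite is_pinnacle_cons (lt_gtF zx) andbF.
Qed.

(** * Counting the neighbours of pinnacles *)

Lemma in_pinnacle_set s x : (x \in pinnacle_set s) = is_pinnacle s x && (x \in s).
Proof. by rewrite !inE andbC. Qed.

Lemma pinnacle_mem s x : is_pinnacle s x -> x \in s.
Proof. by case/existsP=> i /and5P[_ _ /eqP <- _ _]; rewrite mem_nth. Qed.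

(** If a neighbour of [x] were also a pinnacle, each of the two would exceed the other. *)
Lemma pinnacle_neighbour x0 s x j : uniq s -> is_pinnacle s x ->
    j = (index x s).-1 \/ j = (index x s).+1 ->
  [/\ (j < size s)%N, ~~ is_pinnacle s (nth x0 s j) & nth x0 s j < x].
Proof.
move=> us px; have xs := pinnacle_mem px.
move: px; rewrite (is_pinnacle_index _ us) => /and4P[i0 i1 l r] ij.
have js : (j < size s)%N by case: ij => ->; lia.
have jx : nth x0 s j < x.
  by rewrite (set_nth_default x) //; case: ij => ->.
split=> //; rewrite (is_pinnacle_index _ us) index_uniq //.
apply/and4P => -[j0 j1 jl jr]; have := jx; apply/negP; rewrite -leNgt ltW //.
rewrite -[X in X < _](nth_index x0 xs).
case: ij => ji.
  by move: jr; rewrite (set_nth_default x0) // ji prednK.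
by move: jl; rewrite (set_nth_default x0) ji //= ltnW.
Qed.

(* The left neighbours of the pinnacles that are at most p, together with the
   right neighbour of the rightmost of these pinnacles, are distinct. *)
Lemma pinnacle_count s p : uniq s -> is_pinnacle s p ->
  (#|` [fset x in pinnacle_set s | (x <= p)%O]|
     < #|` [fset x in s | ~~ is_pinnacle s x & (x < p)%O]|)%N.
Proof.
move=> us pp; set A := [fset x in pinnacle_set s | _].
set B := [fset x in s | _].
have inA x : x \in A -> is_pinnacle s x /\ x <= p.
  by rewrite !inE -andbA => /and3P[].
have pA : p \in A by rewrite !inE pinnacle_mem //= pp lexx.
have nbB x j : x \in A -> j = (index x s).-1 \/ j = (index x s).+1 ->
    (j < size s)%N /\ nth p s j \in B.
  move=> /inA[px xp] jx; have [js nj lj] := pinnacle_neighbour p us px jx.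
  by split=> //; rewrite !inE mem_nth //= nj (lt_le_trans lj).
have i_gt0 x : x \in A -> (0 < index x s)%N.
  by move=> /inA[]; rewrite (is_pinnacle_index _ us) => /and4P[].
have [m mA mmax] : exists2 m, m \in A &
    {in A, forall x, (index x s <= index m s)%N}.
  pose Q k := has (fun x => index x s == k) A.
  have exQ : exists k, Q k.
    by exists (index p s); apply/hasP; exists p.
  have ubQ k : Q k -> (k <= size s)%N by case/hasP=> x _ /eqP <-; exact: index_size.
  case: (ex_maxnP exQ ubQ) => k /hasP[m mA /eqP <-] kmax.
  by exists m => // x xA; apply: kmax; apply/hasP; exists x.
pose L := nth p s (index m s).+1 :: [seq nth p s (index x s).-1 | x <- A].
have -> : #|` A|.+1 = size L by rewrite /= size_map.
apply: uniq_leq_size; last first.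
  move=> y; rewrite in_cons => /orP[/eqP->|/mapP[x xA ->]].
    by case: (nbB m _ mA (or_intror erefl)).
  by case: (nbB x _ xA (or_introl erefl)).
rewrite /=; apply/andP; split.
  (* By maximality of [index m s], the position [(index m s).+1] lies beyond every
     [(index x s).-1]. *)
  apply/mapP => -[x xA] /eqP.
  have [js _] := nbB m _ mA (or_intror erefl).
  have [ks _] := nbB x _ xA (or_introl erefl).
  by rewrite nth_uniq // => /eqP; have := mmax x xA; lia.
rewrite map_inj_in_uniq ?fset_uniq // => x y xA yA /eqP.
have [js _] := nbB x _ xA (or_introl erefl).
have [ks _] := nbB y _ yA (or_introl erefl).
rewrite nth_uniq // => /eqP ji.
(* The predecessor is injective on these indices because they are positive. *)
have {}ji : index x s = index y s by have := i_gt0 x xA; have := i_gt0 y yA; lia.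
have As z : z \in A -> z \in s by move=> /inA[/pinnacle_mem].
by rewrite -(nth_index p (As x xA)) ji nth_index ?As.
Qed.

(** * The counting criterion for pinnacle sets *)

Lemma APS_P X S : APS X S <-> (S `<=` X)%fset /\
  {in S, forall p, (#|` [fset x in S | (x <= p)%O]|
                      < #|` [fset x in (X `\` S)%fset | (x < p)%O]|)%N}.
Proof.
split=> [[s [us sX <-]]|[SX SC]].
  split.
    by apply/fsubsetP => x; rewrite in_pinnacle_set -sX => /andP[].
  move=> p; rewrite in_pinnacle_set => /andP[pp _].
  apply: leq_trans (pinnacle_count us pp) _; apply: fsubset_leq_card.
  apply/fsubsetP => x; rewrite !inE /= -sX => /and3P[-> np ->].
  by rewrite (negbTE np) andbF.
pose srt (Z : {fset T}) := sort <=%O Z.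
have srt_s Z : sorted <%O (srt Z).
  by rewrite sort_lt_sorted fset_uniq.
have mem_srt Z : srt Z =i Z by move=> x; rewrite mem_sort.
have cnt (Z : {fset T}) (Q : pred T) : #|` [fset x in Z | Q x]| = count Q (srt Z).
  rewrite -size_filter; apply/perm_size/uniq_perm; rewrite ?fset_uniq //.
    by rewrite filter_uniq // sort_uniq fset_uniq.
  by move=> x; rewrite mem_filter mem_srt !inE andbC.
set a := srt S; set v := srt (X `\` S)%fset.
(* Counting from 0, entry [i] of [a] has [i.+1] elements of [S] at most it, so at least [i.+2]
   valleys lie below it. In particular valley [i.+1] does, as [is_pinnacle_zigzag] requires. *)
have key i x0 : (i < size a)%N -> (i.+1 < count (< nth x0 a i) v)%N.
  move=> ia; have := SC (nth x0 a i); rewrite -(mem_srt S) mem_nth // => /(_ isT).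
  by rewrite !cnt -(size_filter _ a) filter_le_nth ?srt_s // size_takel.
have av : (a != [::] -> size a < size v)%N.
  (* The largest pinnacle, at index [(size a).-1], already has more than [size a] valleys below
     it. *)
  case aE : a => [|x0 a'] // _; have := key (size a).-1 x0.
  by rewrite aE /= ltnS => /(_ (leqnn _)) /leq_trans; apply; exact: count_size.
have pz : perm_eq (zigzag v a) (v ++ a).
  by apply: perm_zigzag; case: (a) av => // ? ? /(_ isT) /ltnW.
exists (zigzag v a); split.
- rewrite (perm_uniq pz) cat_uniq !sort_uniq !fset_uniq andbT /=.
  by apply/hasPn => x; rewrite !mem_srt inE => ->.
- move=> x; rewrite (perm_mem pz) mem_cat !mem_srt inE.
  by case: (boolP (x \in S)) => //= xS; rewrite ?orbF // (fsubsetP SX).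
- apply/fsetP => x; rewrite in_pinnacle_set.
  rewrite (@is_pinnacle_zigzag x v a) ?srt_s // => [|i ia].
    rewrite (perm_mem pz) mem_cat /a mem_srt.
    by case: (x \in S); rewrite ?orbT.
  exact: nth_count_lt (sort_le_sorted _) (key i x ia).
Qed.

End AdmissiblePinnacleSets.

(** * Signed permutations as arrangements of signed sets *)

Lemma mem_pos_range n x : (x \in pos_range n) = (0 < x <= n%:Z).
Proof.
apply/imfsetP/idP => /= [[i]|xn].
  by rewrite mem_iota => /andP[i0 i1] ->; lia.
by exists `|x|%N; [rewrite mem_iota; lia | lia].
Qed.

Lemma mem_fset_opp (X : {fset int}) x : (x \in fset_opp X) = (- x \in X).
Proof.
apply/imfsetP/idP => /= [[y yX ->]|xX]; first by rewrite opprK.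
by exists (- x); rewrite ?opprK.
Qed.

Lemma mem_pm_range n x : (x \in pm_range n) = (0 < `|x| <= n%:Z).
Proof. by rewrite inE mem_fset_opp !mem_pos_range; lia. Qed.

Lemma card_pos_range n : #|` pos_range n| = n.
Proof. by rewrite card_imfset /= ?undup_id ?size_iota ?iota_uniq // => i j []. Qed.

Lemma card_fset_opp (X : {fset int}) : #|` fset_opp X| = #|` X|.
Proof. by rewrite card_imfset //; exact: oppr_inj. Qed.

(** The entries of a one-line notation choose one element of each pair [x], [- x]; conversely, any
    arrangement of such a choice extends to a signed permutation by oddness. *)
Lemma APSB_signed_choice n (S : {fset int}) :
  APSB n S <-> exists X, [/\ X `<=` pm_range n, signed_set X, #|` X| = n & APS X S].
Proof.
split=> [[w [[wpm winj _ wN] <-]]|[X [Xpm sX cX [s [us sXE <-]]]]].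
  have us : uniq (one_line n w).
    rewrite map_inj_in_uniq ?iota_uniq // => i j.
    rewrite !mem_iota => ni nj /winj; rewrite !mem_pm_range => ij.
    by have := ij ltac:(lia) ltac:(lia); lia.
  have inX x : x \in one_line n w -> exists2 i, i \in pos_range n & x = w i.
    move=> /mapP[i]; rewrite mem_iota => ni ->.
    by exists i%:Z; rewrite ?mem_pos_range //; lia.
  exists [fset x in one_line n w]; split.
  - apply/fsubsetP => x; rewrite inE => /inX[i].
    by rewrite mem_pos_range => ni ->; apply: wpm; rewrite mem_pm_range; lia.
  - move=> x; rewrite !inE => /inX[i]; rewrite mem_pos_range => ni ->.
    apply/negP => /inX[j]; rewrite mem_pos_range => nj.
    rewrite -wN ?mem_pm_range; last by lia.
    by move/winj; rewrite !mem_pm_range => /(_ ltac:(lia) ltac:(lia)); lia.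
  - by rewrite card_fseq undup_id // size_map size_iota.
  - by exists (one_line n w); split=> // x; rewrite inE.
have szs : size s = n.
  by rewrite -cX; apply/perm_size/uniq_perm; rewrite ?fset_uniq.
(* Position [|i|] counts from 1 but [nth] from 0; the default 0 is not reached for [i] in
   [pm_range n]. *)
pose f (i : int) := nth 0 s `|i|%N.-1.
pose w i := if 0 < i then f i else - f i.
have ltn i : i \in pm_range n -> (`|i|%N.-1 < size s)%N.
  by rewrite mem_pm_range szs; lia.
have fX i : i \in pm_range n -> f i \in X by move=> /ltn ni; rewrite -sXE mem_nth.
have f_inj i j : i \in pm_range n -> j \in pm_range n -> f i = f j -> `|i|%N = `|j|%N.
  move=> ni nj /eqP; rewrite nth_uniq ?ltn //.
  by move: ni nj; rewrite !mem_pm_range => ? ? /eqP; lia.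
have pmN i : (- i \in pm_range n) = (i \in pm_range n).
  by rewrite !mem_pm_range normrN.
have wpm : {in pm_range n, forall i, w i \in pm_range n}.
  by move=> i ni; rewrite /w; case: ifP => _; rewrite ?pmN (fsubsetP Xpm) ?fX.
have winj : {in pm_range n &, injective w}.
  move=> i j ni nj; rewrite /w.
  (* Arguments of opposite sign cannot collide, because [X] never contains both [x] and [- x]. *)
  have dif k l : k \in pm_range n -> l \in pm_range n -> f k = - f l -> False.
    by move=> nk nl e; have := sX _ (fX _ nl); rewrite -e fX.
  case: ifP => i0; case: ifP => j0.
  - by move/f_inj => /(_ ni nj); lia.
  - by move/dif => /(_ ni nj).
  - by move/esym/dif => /(_ nj ni).
  - move/oppr_inj/f_inj => /(_ ni nj).
    by move: ni nj; rewrite !mem_pm_range; lia.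
exists w; split; last first.
  congr (pinnacle_set _); apply: (@eq_from_nth _ 0).
    by rewrite size_map size_iota szs.
  move=> i; rewrite size_map size_iota => ni.
  by rewrite (nth_map 0%N) ?size_iota // nth_iota.
split=> // [j nj|i]; last first.
  rewrite mem_pm_range /w /f => ni; rewrite abszN.
  by case: ifP => i0; case: ifP => j0; rewrite ?opprK //; lia.
(* Surjectivity: an injective self-map of a finite set is onto. *)
have /eqP wE : [fset w i | i in pm_range n] == pm_range n.
  rewrite eqEfcard (_ : #|` [fset w i | i in pm_range n]| = #|` pm_range n|).
    rewrite leqnn andbT.
    by apply/fsubsetP => x /imfsetP[i ni ->]; exact: wpm.
  by rewrite card_in_imfset.
by move: nj; rewrite -{1}wE => /imfsetP[i ni ->]; exists i.
Qed.

(** * The characterization for signed permutations *)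

Theorem theorem3p9 (n : nat) (hn : (0 < n)%N) (S : {fset int})
    (hS : S `<=` pm_range n) (hsigned : signed_set S) :
  APSB n S <->
  [/\ (#|` pos_part n S| + #|` neg_part n S|)%:R <= (n%:R - 1) / 2%:R :> rat,
      pos_part n S `<=` pos_range n,
      neg_part n S `<=` fset_opp (pos_range n `\` pos_part n S)
    & APS (fset_opp (pos_range n `\` pos_part n S)) (neg_part n S)].
Proof.
set P := pos_part n S; set N := neg_part n S.
set Y := fset_opp (pos_range n `\` P).
have inP x : (x \in P) = (x \in S) && (0 < x <= n%:Z).
  by rewrite inE mem_pos_range.
have inN x : (x \in N) = (x \in S) && (0 < - x <= n%:Z).
  by rewrite inE mem_fset_opp mem_pos_range.
have inY x : (x \in Y) = (0 < - x <= n%:Z) && (- x \notin S).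
  rewrite mem_fset_opp inE inP mem_pos_range.
  by case: (0 < - x <= n%:Z); rewrite ?andbT ?andbF.
have Spm x : x \in S -> 0 < `|x| <= n%:Z by move/(fsubsetP hS); rewrite mem_pm_range.
have NY : N `<=` Y.
  by apply/fsubsetP => x; rewrite inN inY => /andP[/hsigned -> ->].
have PS : P `<=` pos_range n by apply: fsubsetIr.
have dPN : [disjoint P & N].
  by apply/fdisjointP => x; rewrite inP inN => /andP[-> ?]; lia.
have SE : S = P `|` N.
  apply/fsetP => x; rewrite in_fsetU inP inN.
  by case: (boolP (x \in S)) => //= /Spm; lia.
have cS : (#|` P| + #|` N|)%N = #|` S|.
  by rewrite SE cardfsU disjoint_fsetI0 // cardfs0 subn0.
have cY : #|` Y| = (n - #|` P|)%N.
  by rewrite card_fset_opp cardfsD fsetIC (fsetIidPl PS) card_pos_range.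
have -> : ((#|` P| + #|` N|)%:R <= (n%:R - 1) / 2%:R :> rat) = (#|` S|.*2 < n)%N.
  rewrite cS ler_pdivlMr ?ltr0n // lerBrDr -natrM natr1 ler_nat.
  by rewrite muln2.
rewrite APSB_signed_choice; split=> [[X [Xpm sX cX /APS_P[SX SC]]]|[i1 _ _ /APS_P[_ NC]]].
  split=> //.
    case: (fset_0Vmem S) => [->|[p0 p0S]]; first by rewrite cardfs0.
    (* At the largest element of [S] the criterion counts all of [S], giving
       [|S| < |X \ S| = n - |S|]. *)
    have [p pS pmax] : exists2 p, p \in S & {in S, forall x, x <= p}.
      case: (@arg_maxP _ _ S [` p0S] predT val) => // p _ pmax.
      by exists (val p) => [|x xS]; [exact: valP | exact: (pmax [` xS])].
    have := SC p pS; rewrite (_ : [fset x in S | _] = S); last first.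
      by apply/fsetP => x; rewrite !inE; apply: andb_idr => /pmax.
    have : (#|` [fset x in X `\` S | (x < p)%R]| <= #|` X `\` S|)%N.
      by apply: fsubset_leq_card; apply/fsubsetP => x; rewrite !inE => /andP[].
    move=> c1 c2; have := leq_trans c2 c1.
    by rewrite cardfsD fsetIC (fsetIidPl SX) cX ltn_subRL addnn.
  apply/APS_P; split=> // p pN; have pS : p \in S by move: pN; rewrite inN => /andP[].
  apply: leq_ltn_trans (leq_trans (SC p pS) _).
    apply: fsubset_leq_card; apply/fsubsetP => x; rewrite !inE.
    by rewrite -andbA => /and3P[-> _ ->].
  have Xabs x z : x \in X -> z \in X -> `|x| = `|z| -> x = z.
    move=> xX zX; have := sX x xX; case: (eqVneq z (- x)) => [<-|]; first by rewrite zX.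
    by lia.
  pose A := [fset x in X `\` S | x < p].
  have inA x : x \in A -> [/\ x \in X, x \notin S & x < p].
    by rewrite !inE -andbA => /and3P[].
  (* The map sending [x] to [- |x|] is injective on the signed set [X] and never increases a value,
     so it carries [A] into the part of [Y \ N] below [p]. *)
  have <- : #|` [fset - `|x| | x in A]| = #|` A|.
    rewrite card_in_imfset // => x y /inA[xX _ _] /inA[yX _ _] /oppr_inj.
    exact: Xabs.
  apply: fsubset_leq_card; apply/fsubsetP => _ /imfsetP[x /inA[xX xS xp] ->].
  have absS z : `|x| = `|z| -> z \notin S.
    move=> xz; apply: contra xS => zS.
    by rewrite (Xabs _ _ xX (fsubsetP SX _ zS) xz).
  have := fsubsetP Xpm _ xX; rewrite mem_pm_range => xn.
  rewrite !inE inY opprK (absS `|x|) ?normr_id // (negbTE (absS (- `|x|) _)) /=.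
    by move: xp xn; lia.
  by rewrite normrN normr_id.
have dPY : [disjoint P & Y].
  by apply/fdisjointP => x; rewrite inP inY => /andP[? ?]; lia.
(* This choice contains [S = P U N] and gives every other element the negative sign, hence as many
   small non-pinnacles as possible. *)
exists (P `|` Y); split.
- apply/fsubsetP => x; rewrite in_fsetU inP inY mem_pm_range.
  by move=> /orP[/andP[_ ?]|/andP[? _]]; lia.
- move=> x; rewrite !in_fsetU !inP !inY opprK.
  by case: (boolP (x \in S)) => [xS|_] /=; rewrite ?(negbTE (hsigned _ xS)) /=; lia.
- by rewrite cardfsU disjoint_fsetI0 // cardfs0 subn0 cY; lia.
apply/APS_P; split=> [|p pS].
  by rewrite {1}SE fsetUS.
have YX : Y `\` N `<=` (P `|` Y) `\` S.
  apply/fsubsetP => x; rewrite !in_fsetD in_fsetU inN inY.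
  by case: (0 < - x <= n%:Z) => /=; rewrite ?andbF ?andbT // => /andP[-> ->]; rewrite orbT.
move: (pS); rewrite {1}SE in_fsetU => /orP[pP|pN].
  (* For positive [p], all of [Y \ N] is negative and so below [p]; its size [n - |S|] exceeds [|S|]
     by (i). *)
  apply: (@leq_ltn_trans #|` S|).
    by apply: fsubset_leq_card; apply/fsubsetP => x; rewrite !inE => /andP[].
  apply: (@leq_trans #|` Y `\` N|).
    by rewrite cardfsD fsetIC (fsetIidPl NY) cY; lia.
  apply: fsubset_leq_card; apply/fsubsetP => x xYN.
  have := fsubsetP YX _ xYN; rewrite !inE => -> /=.
  move: xYN pP; rewrite in_fsetD inY inP => /and3P[_ ? _] /andP[_ ?].
  by lia.
(* For negative [p], every element of [S] at most [p] is negative and so lies in [N]: the criterion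
   for [N] in [Y] applies. *)
apply: leq_ltn_trans (leq_trans (NC p pN) _).
  apply: fsubset_leq_card; apply/fsubsetP => x; rewrite !inE /=.
  rewrite mem_fset_opp mem_pos_range => /andP[xS xp]; rewrite xS xp andbT /=.
  by have := Spm x xS; move: pN xp; rewrite inN => /andP[_]; lia.
apply: fsubset_leq_card; apply/fsubsetP => x; have := fsubsetP YX x.
by rewrite !inE => YXx /andP[/YXx -> ->].
Qed.
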